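(* Let $R$ be a real closed field extension of $\mathbb{R}$, let $\Lambda$ be a divisible ordered abelian group, let $H=R[[\epsilon^\Lambda]]$, and let $k$ be a positive integer. Let $f\colon\Lambda\to R$ be a function and let $L_f\colon H\to H$ be defined by $L_f\left(\sum_{e\in\Lambda}c_e\epsilon^e\right)=\sum_{e\in\Lambda}f(e)c_e\epsilon^e$. (1) If $f$ is $k$-positive definite, then $L_f$ is $k$-positive. (2) If $L_f$ is $k$-positive, then $f$ is $k$-positive semidefinite.
   Context: $H=R[[\epsilon^\Lambda]]$ is the field of Hahn series over $R$ with value group $\Lambda$ (formal sums $\sum_{e\in\Lambda}c_e\epsilon^e$, $c_e\in R$, with well-ordered support). It is a real closed field, ordered by $x\le y\Leftrightarrow\exists z\,(z^2+x=y)$. A map $L\colon H\to H$ is $k$-positive if for every symmetric positive semidefinite $k\times k$ matrix $A=(a_{ij})$ with entries in $H$ the matrix $(L(a_{ij}))_{i,j}$ is positive semidefinite. A function $f\colon\Lambda\to R$ is $k$-positive semidefinite if for all $x_1,\dots,x_k\in\Lambda$ the matrix $(f(x_i+x_j))_{1\le i,j\le k}$ is positive semidefinite; it is $k$-positive definite if for all pairwise different $x_1,\dots,x_k\in\Lambda$ the matrix $(f(x_i+x_j))_{1\le i,j\le k}$ is positive definite.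
   Formalization: In part (1), for k > 1, the group Λ is assumed nontrivial: if Λ = 0 and k ≥ 2, every f is vacuously k-positive definite, and f = −1 gives L_f = −id, which is not k-positive. *)

(* Defs.v *)
From HB Require Import structures.
From mathcomp Require Import all_boot all_order all_algebra.
From mathcomp Require Import mathcomp_extra boolp classical_sets functions.
From mathcomp Require Import cardinality fsbigop reals.

Set Implicit Arguments.
Unset Strict Implicit.
Unset Printing Implicit Defensive.

Import Order.TTheory GRing.Theory Num.Theory.

Local Open Scope classical_set_scope.
Local Open Scope ring_scope.

(* MathComp's porderZmodType does not relate the order and the addition.
   Totality is part of the mixin because Hierarchy-Builder rejects a join of
   Order.Total and POrderedZmodule that is not declared before RealDomain. *)
HB.mixin Record POrderedZmodule_isOrdered G of Num.POrderedZmodule G := {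
  lerD2l_subproof : forall z x y : G, x <= y -> z + x <= z + y;
  le_total_subproof : total (<=%R : rel G)
}.

#[short(type="orderedZmodType")]
HB.structure Definition OrderedZmodule :=
  { G of Num.POrderedZmodule G & POrderedZmodule_isOrdered G }.

HB.instance Definition _ (G : orderedZmodType) :=
  Order.POrder_isTotal.Build ring_display (OrderedZmodule.sort G)
    le_total_subproof.

Definition divisible (G : zmodType) :=
  forall (n : nat) (x : G), (0 < n)%N -> exists y : G, y *+ n = x.

Section OrderedZmodTheory.
Variable G : orderedZmodType.
Implicit Types x y z : G.

Lemma ozmod_leD2l z x y : (z + x <= z + y) = (x <= y).
Proof.
apply/idP/idP; last exact: lerD2l_subproof.
by move=> /(lerD2l_subproof (- z)); rewrite !addKr.
Qed.

Lemma ozmod_leD2r z x y : (x + z <= y + z) = (x <= y).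
Proof. by rewrite ![_ + z]addrC ozmod_leD2l. Qed.

Lemma ozmod_leD x y z t : x <= y -> z <= t -> x + z <= y + t.
Proof.
by move=> xy zt; apply: (@le_trans _ _ (y + z));
  rewrite ?ozmod_leD2r ?ozmod_leD2l.
Qed.

Lemma ozmod_leB2l z x y : (z - x <= z - y) = (y <= x).
Proof.
by rewrite -(ozmod_leD2l (x + y - z) (z - x)) addrA subrK addrAC subrr add0r
           addrA subrK addrK.
Qed.

Definition well_ordered (A : set G) :=
  forall S : set G, S `<=` A -> S !=set0 ->
    exists2 m, S m & forall x, S x -> m <= x.

Lemma well_orderedS (A B : set G) :
  A `<=` B -> well_ordered B -> well_ordered A.
Proof. by move=> AB wB S SA; apply: wB => x /SA /AB. Qed.

Lemma well_orderedU (A B : set G) :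
  well_ordered A -> well_ordered B -> well_ordered (A `|` B).
Proof.
move=> wA wB S SAB S0.
have [SA0|nA] := pselect ((S `&` A) !=set0); last first.
  apply: wB => // x Sx; case: (SAB _ Sx) => // Ax.
  by case: nA; exists x.
have [SB0|nB] := pselect ((S `&` B) !=set0); last first.
  apply: wA => // x Sx; case: (SAB _ Sx) => // Bx.
  by case: nB; exists x.
have [a [Sa Aa] amin] := wA _ (@subIsetr _ _ _) SA0.
have [b [Sb Bb] bmin] := wB _ (@subIsetr _ _ _) SB0.
exists (Order.min a b); first by rewrite minEle; case: ifP.
move=> x Sx; rewrite ge_min.
by case: (SAB _ Sx) => [Ax|Bx]; [rewrite (amin x) //|rewrite (bmin x) ?orbT //].
Qed.

Lemma well_ordered_ind (A : set G) (P : G -> Prop) : well_ordered A ->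
  (forall c, A c -> (forall d, A d -> d < c -> P d) -> P c) ->
  forall c, A c -> P c.
Proof.
move=> wA IH c Ac; apply: contrapT => nPc.
have [||m [Am nPm] mmin] := wA [set x | A x /\ ~ P x].
- by move=> x [].
- by exists c.
apply/nPm/IH => // d Ad dm; apply: contrapT => nPd.
by move: (mmin d (conj Ad nPd)); rewrite leNgt dm.
Qed.

Definition sumset (A B : set G) : set G :=
  [set x | exists a b, [/\ A a, B b & x = a + b]].

Let sumsetSl (A A' B : set G) : A `<=` A' -> sumset A B `<=` sumset A' B.
Proof. by move=> AA' _ [a [b [/AA' Aa Bb ->]]]; exists a, b. Qed.

Let sumset_step (A B : set G) : well_ordered B ->
  (forall c, A c -> well_ordered (sumset (A `&` [set a | a < c]) B)) ->
  well_ordered (sumset A B).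
Proof.
move=> wB IH S SAB [s Ss].
have [||b0 [Bb0 [a0 Aa0 S0]] bmin] :=
    wB [set b | B b /\ exists2 a, A a & S (a + b)].
- by move=> b [].
- have [a [b [Aa Bb sE]]] := SAB _ Ss.
  by exists b; split => //; exists a; rewrite -?sE.
have le_above a b : A a -> B b -> S (a + b) -> a0 <= a -> a0 + b0 <= a + b.
  move=> Aa Bb Sab a0a; apply: ozmod_leD => //; apply: bmin.
  by split => //; exists a.
pose S' := S `&` sumset (A `&` [set a | a < a0]) B.
have [S'0|S'0] := pselect (S' !=set0); last first.
  exists (a0 + b0) => // x Sx; have [a [b [Aa Bb xE]]] := SAB _ Sx.
  rewrite xE in Sx *; apply: le_above => //.
  rewrite leNgt; apply/negP => aa0; apply: S'0; exists (a + b).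
  by split => //; exists a, b.
have [|m [Sm _] mmin] := IH _ Aa0 S' _ S'0; first by move=> x [].
exists (Order.min m (a0 + b0)); first by rewrite minEle; case: ifP.
move=> x Sx; rewrite ge_min; have [a [b [Aa Bb xE]]] := SAB _ Sx.
have [aa0|aa0] := ltP a a0.
  by rewrite mmin //; split => //; exists a, b.
by rewrite xE in Sx *; rewrite le_above ?orbT.
Qed.

Lemma well_ordered_sumset (A B : set G) :
  well_ordered A -> well_ordered B -> well_ordered (sumset A B).
Proof.
move=> wA wB; apply: sumset_step => // c Ac; move: c Ac.
apply: (well_ordered_ind wA) => c Ac IH; apply: sumset_step => // d [Ad /= dc].
apply: well_orderedS (IH d Ad dc); apply: sumsetSl.
by move=> a [[Aa _] ad].
Qed.

(* Both A and its image under x |-> z - x being well ordered, A is finite. *)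
Lemma finite_well_ordered2 (A B : set G) z :
  well_ordered A -> well_ordered B -> (forall a, A a -> B (z - a)) ->
  finite_set A.
Proof.
move=> wA wB AB.
have maxA S : S `<=` A -> S !=set0 ->
    exists2 m, S m & forall x, S x -> x <= m.
  move=> SA [s Ss]; have [||m Sm mmin] := wB [set b | S (z - b)].
  - by move=> b /SA/AB; rewrite subKr.
  - by exists (z - s); rewrite /= subKr.
  exists (z - m) => // x Sx.
  by rewrite -(ozmod_leB2l z) subKr; apply: mmin; rewrite /= subKr.
have step S : S `<=` A ->
    (forall c, S c -> finite_set (S `&` [set a | a < c])) -> finite_set S.
  move=> SA Sfin; have [S0|/set0P/negP/negPn/eqP->] := pselect (S !=set0) => //.
  have [m Sm mmax] := maxA S SA S0.
  apply: (@sub_finite_set _ _ ((S `&` [set a | a < m]) `|` [set m])).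
    move=> x Sx; have := mmax _ Sx; rewrite le_eqVlt => /orP[/eqP->|xm].
      by right.
    by left.
  by rewrite finite_setU; split => //; exact: Sfin.
apply: (step) => // c Ac; move: c Ac.
apply: (well_ordered_ind wA) => c Ac IH; apply: (step); first by move=> a [].
move=> d [Ad /= dc]; apply: sub_finite_set (IH d Ad dc).
by move=> a [[Aa _] ad].
Qed.

End OrderedZmodTheory.

Section HahnSeries.
Variables (G : orderedZmodType) (R : nzRingType).

Definition hsupp (f : G -> R) : set G := [set e | f e != 0].

Definition wo_supp : {pred G -> R} :=
  fun f : G -> R => `[< well_ordered (hsupp f) >].

Lemma wo_suppP (f : G -> R) : reflect (well_ordered (hsupp f)) (f \in wo_supp).
Proof. exact: asboolP. Qed.

(* The formal sum of the c_e epsilon^e is encoded by its coefficients e |-> c_e. *)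
Record hahn := Hahn { hcoef :> G -> R; hcoefP : hcoef \in wo_supp }.

HB.instance Definition _ := [isSub for hcoef].
HB.instance Definition _ := [Choice of hahn by <:].

Lemma hahnP (x y : hahn) : hcoef x =1 hcoef y -> x = y.
Proof. by move=> xy; apply/val_inj/funext. Qed.

Lemma hsuppP (x : hahn) : well_ordered (hsupp x).
Proof. exact/wo_suppP/hcoefP. Qed.

Fact wo_supp_zmod : zmod_closed wo_supp.
Proof.
split=> [|f g /wo_suppP wf /wo_suppP wg]; apply/wo_suppP.
  by move=> S S0 [x /S0]; rewrite /hsupp /= eqxx.
apply: well_orderedS (well_orderedU wf wg) => e /=.
rewrite /hsupp /=; apply: contra_neqP => /not_orP[].
by move=> /negP/negPn/eqP f0 /negP/negPn/eqP g0; rewrite !fctE f0 g0 subrr.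
Qed.
HB.instance Definition _ := GRing.isZmodClosed.Build (G -> R) wo_supp wo_supp_zmod.
HB.instance Definition _ := [SubChoice_isSubZmodule of hahn by <:].

Lemma hcoefD (x y : hahn) e : (x + y) e = x e + y e.
Proof. by []. Qed.

(* epsilon^e *)
Definition hmono_fun (e : G) : G -> R := fun e' => (e' == e)%:R.

Lemma hmono_subproof e : hmono_fun e \in wo_supp.
Proof.
apply/wo_suppP => S SE [s Ss]; exists s => // x Sx.
suff E y : S y -> y = e by rewrite (E _ Ss) (E _ Sx).
move=> /SE; rewrite /hsupp /hmono_fun /=.
by case: (eqVneq y e) => // _; rewrite eqxx.
Qed.
Definition hmono e : hahn := Hahn (hmono_subproof e).

(* The terms with x a * y (e - a) <> 0 are finitely many, see hmul_finite. *)
Definition hmul_fun (x y : hahn) : G -> R :=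
  fun e => \sum_(a \in [set: G]) x a * y (e - a).

Definition hmul_supp (x y : hahn) (e : G) : set G :=
  [set a | hsupp x a /\ hsupp y (e - a)].

Lemma hmul_finite (x y : hahn) e : finite_set (hmul_supp x y e).
Proof.
apply: (@finite_well_ordered2 _ _ (hsupp y) e); last by move=> a [].
  by apply: (@well_orderedS _ _ (hsupp x)); [move=> a []|exact: hsuppP].
exact: hsuppP.
Qed.

Lemma hmul_widen (x y : hahn) e (D : set G) : hmul_supp x y e `<=` D ->
  hmul_fun x y e = \sum_(a \in D) x a * y (e - a).
Proof.
move=> sD; apply/esym/fsbig_widen => // a [_ /= nDa]; apply: contrapT => xy.
apply: nDa; apply: sD; split; apply/negP => /eqP E; apply: xy;
  by rewrite E ?mul0r ?mulr0.
Qed.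

Lemma hmul_funE (x y : hahn) e :
  hmul_fun x y e = \sum_(a \in hmul_supp x y e) x a * y (e - a).
Proof. exact: hmul_widen. Qed.

Lemma hmul_supp_sumset (x y : hahn) :
  hsupp (hmul_fun x y) `<=` sumset (hsupp x) (hsupp y).
Proof.
move=> e; rewrite /hsupp /=; apply: contra_neqP => nS.
rewrite hmul_funE fsbig1 // => a [xa ya]; case: nS.
by exists a, (e - a); split; rewrite ?[a + _]addrC ?subrK.
Qed.

Lemma hmul_subproof (x y : hahn) : hmul_fun x y \in wo_supp.
Proof.
apply/wo_suppP; apply: well_orderedS (@hmul_supp_sumset x y) _.
by apply: well_ordered_sumset; exact: hsuppP.
Qed.
Definition hmul (x y : hahn) : hahn := Hahn (hmul_subproof x y).

Let hmul1 : left_id (hmono 0) hmul.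
Proof.
move=> x; apply: hahnP => e; rewrite /= (@hmul_widen _ _ _ [set 0]).
  by rewrite fsbig_set1 /= /hmono_fun eqxx mul1r subr0.
move=> a [+ _]; rewrite /hsupp /= /hmono_fun.
by case: (eqVneq a 0) => // _; rewrite eqxx.
Qed.

Let hmulr1 : right_id (hmono 0) hmul.
Proof.
move=> x; apply: hahnP => e; rewrite /= (@hmul_widen _ _ _ [set e]).
  by rewrite fsbig_set1 /= /hmono_fun subrr eqxx mulr1.
move=> a [_]; rewrite /hsupp /= /hmono_fun subr_eq0.
by case: (eqVneq e a) => [->|_] //; rewrite eqxx.
Qed.

Let fsumD (D : set G) (f g : G -> R) : finite_set D ->
  \sum_(a \in D) (f a + g a) = \sum_(a \in D) f a + \sum_(a \in D) g a.
Proof. exact: fsbig_split. Qed.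

Let hmulDl : left_distributive hmul +%R.
Proof.
move=> x y z; apply: hahnP => e; rewrite hcoefD /=.
pose D := hmul_supp (x + y) z e `|` hmul_supp x z e `|` hmul_supp y z e.
have Dfin : finite_set D by rewrite !finite_setU; do !split; exact: hmul_finite.
rewrite !(@hmul_widen _ _ _ D) -?fsumD //; try by move=> a; rewrite /D /=; tauto.
by apply: eq_fsbigr => a _; rewrite hcoefD mulrDl.
Qed.

Let hmulDr : right_distributive hmul +%R.
Proof.
move=> x y z; apply: hahnP => e; rewrite hcoefD /=.
pose D := hmul_supp x (y + z) e `|` hmul_supp x y e `|` hmul_supp x z e.
have Dfin : finite_set D by rewrite !finite_setU; do !split; exact: hmul_finite.
rewrite !(@hmul_widen _ _ _ D) -?fsumD //; try by move=> a; rewrite /D /=; tauto.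
by apply: eq_fsbigr => a _; rewrite hcoefD mulrDr.
Qed.

Let hmulA : associative hmul.
Proof.
move=> x y z; apply: hahnP => e /=.
have wyz : well_ordered (sumset (hsupp y) (hsupp z)).
  by apply: well_ordered_sumset; exact: hsuppP.
have wxy : well_ordered (sumset (hsupp x) (hsupp y)).
  by apply: well_ordered_sumset; exact: hsuppP.
pose A := [set a | hsupp x a /\ sumset (hsupp y) (hsupp z) (e - a)].
(* c plays the role of the exponent in x * y *)
pose C := [set c | sumset (hsupp x) (hsupp y) c /\ hsupp z (e - c)].
have Afin : finite_set A.
  apply: (finite_well_ordered2 _ wyz (z := e)) => [|a []] //.
  by apply: (@well_orderedS _ _ (hsupp x)); [move=> a []|exact: hsuppP].
have Cfin : finite_set C.
  apply: (@finite_well_ordered2 _ C (hsupp z) e); [|exact: hsuppP|by move=> a []].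
  by apply: (well_orderedS _ wxy) => a [].
transitivity (\sum_(a \in A) \sum_(c \in C) x a * (y (c - a) * z (e - c))).
  rewrite (@hmul_widen _ _ _ A); last first.
    by move=> a [xa /hmul_supp_sumset yz]; split.
  apply: eq_fsbigr => a /set_mem[xa _] /=.
  rewrite (@hmul_widen _ _ _ [set c - a | c in C]).
    rewrite fsbig_image; last by move=> u v _ _ /addIr.
    rewrite fsbig_distrr //; apply: eq_fsbigr => c _.
    by rewrite opprB addrA subrK.
  move=> b [yb zb]; exists (a + b); last by rewrite addrC addKr.
  by split; [exists a, b|rewrite opprD addrA].
rewrite (@hmul_widen _ _ _ C); last first.
  by move=> c [/hmul_supp_sumset xy zc]; split.
rewrite exchange_fsbig //; apply: eq_fsbigr => c /set_mem[_ zc] /=.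
rewrite (@hmul_widen _ _ _ A); last first.
  move=> a [xa yca]; split => //; exists (c - a), (e - c); split => //.
  by rewrite [RHS]addrC addrA subrK.
rewrite !fsbig_finite // mulr_suml.
by apply: eq_bigr => a _; rewrite mulrA.
Qed.

Let hmul1_neq0 : hmono 0 != 0.
Proof.
apply/eqP => /(congr1 (fun x : hahn => x 0)) /eqP.
by rewrite /= /hmono_fun eqxx oner_eq0.
Qed.

HB.instance Definition _ := GRing.Zmodule_isNzRing.Build hahn
  hmulA hmul1 hmulr1 hmulDl hmulDr hmul1_neq0.

Lemma hcoefM (x y : hahn) e :
  (x * y) e = \sum_(a \in [set: G]) x a * y (e - a).
Proof. by []. Qed.

Lemma hahn_diag_subproof (f : G -> R) (x : hahn) :
  (fun e => f e * x e) \in wo_supp.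
Proof.
apply/wo_suppP; apply: (@well_orderedS _ _ (hsupp x)); last exact: hsuppP.
move=> e.
by rewrite /hsupp /=; apply: contra_neq => ->; rewrite mulr0.
Qed.

(* The map L_f *)
Definition hahn_diag (f : G -> R) (x : hahn) : hahn :=
  Hahn (hahn_diag_subproof f x).

End HahnSeries.

Section HahnCom.
Variables (G : orderedZmodType) (R : comNzRingType).

Let hmulC : commutative (@GRing.mul (hahn G R)).
Proof.
move=> x y; apply: hahnP => e; rewrite !hcoefM.
rewrite (@reindex_fsbig _ _ _ _ _ (fun a => e - a) [set: G] [set: G]).
  by apply: eq_fsbigr => a _; rewrite subKr mulrC.
split=> // [a b _ _ /subrI //|a _]; exists (e - a) => //.
by rewrite subKr.
Qed.

HB.instance Definition _ :=
  GRing.PzRing_hasCommutativeMul.Build (hahn G R) hmulC.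
End HahnCom.

Definition hahn_le (G : orderedZmodType) (R : comNzRingType) (x y : hahn G R) :=
  exists z : hahn G R, z ^+ 2 + x = y.

(* The order is a parameter since that of [hahn] is not a library order. *)
Definition psdmx (T : comNzRingType) (le : T -> T -> Prop) (n : nat)
    (A : 'M[T]_n) : Prop :=
  A^T = A /\ forall v : 'cV[T]_n, le 0 ((v^T *m A *m v) 0 0).

Definition pdmx (R : numDomainType) (n : nat) (A : 'M[R]_n) : Prop :=
  A^T = A /\ forall v : 'cV[R]_n, v != 0 -> 0 < (v^T *m A *m v) 0 0.

Definition kpositive (G : orderedZmodType) (R : comNzRingType) (k : nat)
    (L : hahn G R -> hahn G R) : Prop :=
  forall A : 'M[hahn G R]_k,
    psdmx (@hahn_le G R) A -> psdmx (@hahn_le G R) (map_mx L A).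

Definition kpsd (G : zmodType) (R : numDomainType) (k : nat)
    (f : G -> R) : Prop :=
  forall x : 'I_k -> G,
    psdmx (fun a b => a <= b) (\matrix_(i, j) f (x i + x j)).

Definition kpd (G : zmodType) (R : numDomainType) (k : nat)
    (f : G -> R) : Prop :=
  forall x : 'I_k -> G, injective x -> pdmx (\matrix_(i, j) f (x i + x j)).

(* Main.v *)
(* (1) A positive semidefinite matrix over H is B B^T (Cholesky), so by additivity
   of L_f it suffices to bound sum_ij w_i w_j L_f(b_i b_j) below. Since L_f is
   R-linear, elimination over R lets us assume that the w_i are nonzero with
   pairwise different orders o_i. If m is the least order of the b_i w_i, the
   coefficient at 2m is the form f(e_i + e_j) with e_i = m - o_i, evaluated at a
   nonzero vector. As the e_i are distinct, it is positive, and a series with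
   positive leading coefficient is a square.
   (2) Apply L_f to the matrix of the epsilon^(x_i + x_j) and evaluate the
   resulting form at the vector of the c_i epsilon^(-x_i). *)
Require Import Defs.
From HB Require Import structures.
From mathcomp Require Import all_boot all_order all_algebra.
From mathcomp Require Import boolp classical_sets fsbigop reals.
From mathcomp Require Import ring.

Set Implicit Arguments.
Unset Strict Implicit.
Unset Printing Implicit Defensive.

Import Order.TTheory GRing.Theory Num.Theory.

Local Open Scope classical_set_scope.
Local Open Scope ring_scope.

(** * Strict inequalities and upper bounds in ordered groups *)

Section Ozmod.
Variable G : orderedZmodType.
Implicit Types a b c d e : G.

Lemma ozmod_ltD2l c a b : (c + a < c + b) = (a < b).
Proof. by rewrite !lt_neqAle ozmod_leD2l (inj_eq (addrI c)). Qed.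

Lemma ozmod_leBr a b c : (a <= b - c) = (a + c <= b).
Proof. by rewrite -(ozmod_leD2r c) subrK. Qed.

Lemma ozmod_gt0 : (exists e : G, e != 0) -> exists e : G, 0 < e.
Proof.
case=> e; case: (ltgtP e 0) => // e0 _; last by exists e.
by exists (- e); rewrite -(ozmod_ltD2l e) subrr addr0.
Qed.

Lemma ozmod_seq_ub (s : seq G) : (exists e : G, e != 0) ->
  exists m, all (fun a => a < m) s.
Proof.
move=> /ozmod_gt0[e e0]; elim: s => [|a s [m ms]]; first by exists 0.
exists (Order.max a m + e).
have ltM b : b <= Order.max a m -> b < Order.max a m + e.
  by move=> /le_lt_trans; apply; rewrite -[ltLHS]addr0 ozmod_ltD2l.
rewrite /= ltM ?le_max ?lexx //=; apply/allP => b /(allP ms) /ltW bm.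
by rewrite ltM // le_max bm orbT.
Qed.

End Ozmod.

(** * Orders and leading coefficients of Hahn series *)

Section Valuation.
Variables (G : orderedZmodType) (R : nzRingType).
Implicit Types (x y z : hahn G R) (m n e : G).

(** A lower bound on the order of [x]; it holds for [x = 0] and every [m], so the order of the zero
    series never has to be named. *)
Definition vanish_below x m := forall e, e < m -> x e = 0.

Lemma hcoefN x e : (- x) e = - x e. Proof. by []. Qed.
Lemma hcoefB x y e : (x - y) e = x e - y e. Proof. by []. Qed.
Lemma hcoef1 e : (1 : hahn G R) e = (e == 0)%:R. Proof. by []. Qed.

Lemma hcoef_sum (I : Type) (r : seq I) (P : pred I) (F : I -> hahn G R) e :
  (\sum_(i <- r | P i) F i) e = \sum_(i <- r | P i) F i e.
Proof. by elim/big_rec2 : _ => // i y x _ <-. Qed.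

Lemma vanish_belowW x m n : m <= n -> vanish_below x n -> vanish_below x m.
Proof. by move=> mn xn e em; apply: xn; apply: lt_le_trans mn. Qed.

Lemma vanish_below0 m : vanish_below 0 m. Proof. by []. Qed.

Lemma vanish_belowD x y m :
  vanish_below x m -> vanish_below y m -> vanish_below (x + y) m.
Proof. by move=> xm ym e em; rewrite hcoefD xm ?ym ?addr0. Qed.

Lemma vanish_belowN x m : vanish_below x m -> vanish_below (- x) m.
Proof. by move=> xm e em; rewrite hcoefN xm ?oppr0. Qed.

Lemma vanish_belowB x y m :
  vanish_below x m -> vanish_below y m -> vanish_below (x - y) m.
Proof. by move=> xm ym; apply: vanish_belowD => //; apply: vanish_belowN. Qed.

Lemma vanish_below_sum (I : Type) (r : seq I) (P : pred I)
    (F : I -> hahn G R) m : (forall i, P i -> vanish_below (F i) m) ->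
  vanish_below (\sum_(i <- r | P i) F i) m.
Proof. by move=> Fm e em; rewrite hcoef_sum big1 // => i /Fm ->. Qed.

Lemma vanish_below1 : vanish_below 1 0.
Proof. by move=> e; rewrite hcoef1; case: ltgtP. Qed.

Lemma vanish_below_le x m a : vanish_below x m -> x a != 0 -> m <= a.
Proof. by move=> xm; apply: contraNT; rewrite -ltNge => /xm ->. Qed.

Lemma vanish_belowM x y m n : vanish_below x m -> vanish_below y n ->
  vanish_below (x * y) (m + n).
Proof.
move=> xm yn e emn; rewrite [LHS](@hmul_widen _ _ _ _ _ set0) ?fsbig_set0 //.
move=> a [/(vanish_below_le xm) ma /(vanish_below_le yn)].
rewrite ozmod_leBr => ne; have := lt_le_trans emn (ozmod_leD ma (lexx n)).
by rewrite addrC ltNge ne.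
Qed.

(** Only the index [a = m] contributes to the convolution. The values [x m] and [y n] may vanish, so
    lower bounds on the orders are enough. *)
Lemma hcoefM_lead x y m n : vanish_below x m -> vanish_below y n ->
  (x * y) (m + n) = x m * y n.
Proof.
move=> xm yn; rewrite [LHS](@hmul_widen _ _ _ _ _ [set m]).
  by rewrite fsbig_set1 addrAC subrr add0r.
move=> a [/(vanish_below_le xm) ma /(vanish_below_le yn)].
rewrite ozmod_leBr [m + n]addrC ozmod_leD2l => am.
by apply/eqP; rewrite eq_le am ma.
Qed.

Lemma hahn_leadP x : x != 0 -> exists2 m, vanish_below x m & x m != 0.
Proof.
move=> x0; have [||m xm mmin] := hsuppP (x := x) (S := hsupp x) => //.
  apply: contra_neqP x0 => /set0P/negP/negPn/eqP s0.
  apply: hahnP => e; apply/eqP/negPn/negP => xe.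
  by have : hsupp x e by []; rewrite s0.
exists m => // e em; apply/eqP/negPn/negP => /mmin.
by rewrite leNgt em.
Qed.

(* Junk value: [hord 0 = 0]. *)
Definition hord x : G := xget 0 [set m | vanish_below x m /\ x m != 0].

Lemma hordP x : x != 0 -> vanish_below x (hord x) /\ x (hord x) != 0.
Proof.
move=> /hahn_leadP[m xm xm0]; rewrite /hord.
by case: xgetP => [n -> //|/(_ m) []].
Qed.

Lemma vanish_below_hord x : vanish_below x (hord x).
Proof. by have [->|/hordP[]] := eqVneq x 0. Qed.

Lemma hord_neq0 x : x != 0 -> x (hord x) != 0.
Proof. by move=> /hordP[]. Qed.

Lemma vanish_below_hmono m : vanish_below (hmono R m) m.
Proof. by move=> e; rewrite /= /hmono_fun; case: ltgtP. Qed.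

Lemma hmonoM m n : hmono R m * hmono R n = hmono R (m + n).
Proof.
apply: hahnP => e; rewrite [LHS](@hmul_widen _ _ _ _ _ [set m]).
  rewrite fsbig_set1 /= /hmono_fun eqxx mul1r subr_eq; congr (_%:R).
  by rewrite addrC.
move=> a [+ _]; rewrite /hsupp /= /hmono_fun.
by case: (eqVneq a m) => // _; rewrite eqxx.
Qed.

Definition hconst (c : R) : hahn G R := hahn_diag (fun=> c) 1.

Lemma hcoef_const c e : hconst c e = if e == 0 then c else 0.
Proof. by rewrite /= /hmono_fun; case: eqP; rewrite ?mulr1 ?mulr0. Qed.

Lemma hcoef_constM c x e : (hconst c * x) e = c * x e.
Proof.
rewrite [LHS](@hmul_widen _ _ _ _ _ [set 0]).
  by rewrite fsbig_set1 subr0 hcoef_const eqxx.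
move=> a [+ _]; rewrite /hsupp /= /hmono_fun.
by case: (eqVneq a 0) => // _; rewrite mulr0 eqxx.
Qed.

Lemma hconstM c d : hconst c * hconst d = hconst (c * d).
Proof.
by apply: hahnP => e; rewrite hcoef_constM !hcoef_const; case: eqP;
  rewrite ?mulr0.
Qed.

Lemma hconst1 : hconst 1 = 1.
Proof. by apply: hahnP => e; rewrite /= mul1r. Qed.

Lemma vanish_below_constM c x m :
  vanish_below x m -> vanish_below (hconst c * x) m.
Proof. by move=> xm e em; rewrite hcoef_constM xm ?mulr0. Qed.

Section Diag.
Variable f : G -> R.
Let L := hahn_diag f.

Lemma hcoef_diag x e : L x e = f e * x e. Proof. by []. Qed.

Lemma hahn_diag_hmono m : L (hmono R m) = hconst (f m) * hmono R m.
Proof.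
apply: hahnP => e; rewrite hcoef_diag hcoef_constM /= /hmono_fun.
by case: eqP => [->|]; rewrite ?mulr0.
Qed.

Lemma hahn_diag_sum (I : Type) (r : seq I) (P : pred I) (F : I -> hahn G R) :
  L (\sum_(i <- r | P i) F i) = \sum_(i <- r | P i) L (F i).
Proof.
by apply: hahnP => e; rewrite hcoef_diag !hcoef_sum mulr_sumr.
Qed.

Lemma vanish_below_diag x m : vanish_below x m -> vanish_below (L x) m.
Proof. by move=> xm e em; rewrite hcoef_diag xm ?mulr0. Qed.

End Diag.
End Valuation.

Lemma hahn_diag_constM (G : orderedZmodType) (R : comNzRingType) (f : G -> R)
    (c : R) (x : hahn G R) :
  hahn_diag f (hconst G c * x) = hconst G c * hahn_diag f x.
Proof.
apply: hahnP => e; rewrite hcoef_constM !hcoef_diag hcoef_constM.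
by rewrite mulrCA.
Qed.

(** * Equations with infinitesimal solutions; inverses and square roots *)

Section Solve.
Variables (G : orderedZmodType) (F : fieldType).
Implicit Types (x y z t s : hahn G F) (e g : G).

(** Equivalently, [x] is zero or of positive order. *)
Definition infinitesimal x := vanish_below x 0 /\ x 0 = 0.

Lemma infinitesimalM x y :
  infinitesimal x -> vanish_below y 0 -> infinitesimal (x * y).
Proof.
move=> [x0 x00] y0; split; first by rewrite -(addr0 0); apply: vanish_belowM.
by have := hcoefM_lead x0 y0; rewrite addr0 x00 mul0r.
Qed.

(* The solution of [Phi t = y] is glued from partial solutions, which agree with
   each other: if [t] and [s] first differ at [g], so do [Phi t] and [Phi s]. *)
Section Solution.
Variables (Phi : hahn G F -> hahn G F) (u : F) (y : hahn G F).
Hypotheses (u0 : u != 0) (yinf : infinitesimal y).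
Hypothesis Phi_inf : forall t, infinitesimal t -> infinitesimal (Phi t).
Hypothesis PhiB : forall t s, infinitesimal t -> infinitesimal s ->
  exists K, [/\ Phi t - Phi s = (t - s) * K, vanish_below K 0 & K 0 = u].

Let PhiB_lead t s g : infinitesimal t -> infinitesimal s ->
  vanish_below (t - s) g ->
  vanish_below (Phi t - Phi s) g /\ (Phi t - Phi s) g = (t - s) g * u.
Proof.
move=> ti si tsg; have [K [-> K0 <-]] := PhiB ti si.
by rewrite -[g]addr0; split; [apply: vanish_belowM|rewrite hcoefM_lead ?addr0].
Qed.

Let solves g t := infinitesimal t /\ forall e, e <= g -> Phi t e = y e.

Let solves_uniq g t s : solves g t -> solves g s ->
  forall e, e <= g -> t e = s e.
Proof.
move=> [ti ty] [si sy] e eg; apply: contrapT => tse.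
have ts0 : t - s != 0.
  by apply/eqP => /(congr1 (fun x => hcoef x e)) /eqP; rewrite hcoefB subr_eq0
    => /eqP.
have [m tsm tsm0] := hahn_leadP ts0.
have mg : m <= g.
  rewrite (le_trans _ eg) // (vanish_below_le tsm) // hcoefB subr_eq0.
  exact/eqP.
have [_ /eqP] := PhiB_lead ti si tsm.
by rewrite hcoefB ty // sy // subrr eq_sym mulf_eq0 (negPf tsm0) (negPf u0).
Qed.

(** Each coefficient is read off a partial solution valid up to its own exponent. The default 0
    confines the support to exponents that some partial solution reaches. *)
Let zfun g : F :=
  if pselect (exists t, solves g t) is left ex then projT1 (cid ex) g else 0.

Let zfunE g t e : solves g t -> e <= g -> zfun e = t e.
Proof.
move=> tg eg; rewrite /zfun; case: pselect => [ex|[]]; last first.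
  by exists t; case: tg => ti ty; split=> // d de; rewrite ty // (le_trans de).
case: cid => s /= se; apply: (solves_uniq se) => //.
by case: tg => ti ty; split=> // d de; rewrite ty // (le_trans de).
Qed.

Let zfun_supp g : zfun g != 0 -> exists t, solves g t.
Proof. by rewrite /zfun; case: pselect => //; rewrite eqxx. Qed.

(** Up to a given point of [S], [zfun] coincides with a single Hahn series, whose support is well
    ordered. *)
Let zfun_wo : zfun \in @wo_supp G F.
Proof.
apply/wo_suppP => S SE [a Sa]; have [t ta] := zfun_supp (SE _ Sa).
have [||m [Sm ma] mmin] := hsuppP (x := t) (S := S `&` [set e | e <= a]).
- by move=> e [/SE + /= ea]; rewrite /hsupp /= (zfunE ta).
- by exists a; split=> /=.
exists m => // e Se; have [ea|/ltW ae] := leP e a; first exact: mmin.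
exact: le_trans ae.
Qed.

Let zsol : hahn G F := Hahn zfun_wo.

Let zsol_eq g t e : solves g t -> e <= g -> zsol e = t e.
Proof. exact: zfunE. Qed.

Let zsol_inf : infinitesimal zsol.
Proof.
have z0 e : e <= 0 -> zsol e = 0.
  move=> e0; apply: contrapT => /eqP ze; have [t te] := zfun_supp ze.
  move: ze; rewrite -/(hcoef zsol e) (zsol_eq te) //; case: te => -[t0 t00] _.
  by case: (ltgtP e 0) e0 => // [/t0 ->|-> _]; rewrite ?t00 eqxx.
by split=> [e /ltW|]; exact: z0.
Qed.

Let Phi_zsol g t : solves g t -> Phi zsol g = y g.
Proof.
move=> tg; have [ti ty] := tg.
have zt : vanish_below (zsol - t) g.
  by move=> e /ltW eg; rewrite hcoefB (zsol_eq tg) ?subrr.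
have [_ /eqP] := PhiB_lead zsol_inf ti zt.
by rewrite !hcoefB (zsol_eq tg) // subrr mul0r subr_eq0 ty // => /eqP.
Qed.

(** If [Phi zsol] first differed from [y] at [g], one Newton step from [zsol] would give a partial
    solution up to [g], and then [zsol] would already be correct at [g]. *)
Lemma infinitesimal_solve : exists2 t, infinitesimal t & Phi t = y.
Proof.
exists zsol; first exact: zsol_inf.
apply: contrapT => /eqP; rewrite eq_sym -subr_eq0.
set d := y - _ => d0; have [g dg dg0] := hahn_leadP d0.
suff [t /Phi_zsol yg] : exists t, solves g t.
  by move: dg0; rewrite hcoefB yg subrr eqxx.
have [Pz0 Pz00] := Phi_inf zsol_inf; have [y0 y00] := yinf.
have g0 : 0 < g.
  rewrite lt_neqAle (vanish_below_le _ dg0) ?andbT; last exact: vanish_belowB.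
  by apply: contraNneq dg0 => <-; rewrite hcoefB y00 Pz00 subrr.
(* [Phi] scales the leading coefficient of a difference by [u]; dividing by [u] makes [s] cancel the
   defect [d] at [g]. *)
pose s := hconst G (d g / u) * hmono F g.
have sg : vanish_below s g.
  by apply: vanish_below_constM; apply: vanish_below_hmono.
have si : infinitesimal s.
  by split; [exact: vanish_belowW (ltW g0) sg|exact: sg].
have zsi : infinitesimal (zsol + s).
  case: zsol_inf si => z0 z00 [s0 s00]; split; first exact: vanish_belowD.
  by rewrite hcoefD z00 s00 addr0.
exists (zsol + s); split=> // e; rewrite le_eqVlt.
have zsz : zsol + s - zsol = s by rewrite addrAC subrr add0r.
have := PhiB_lead zsi zsol_inf; rewrite zsz => /(_ g sg)[Peq Pg].
case/predU1P=> [->|eg].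
  apply: (addIr (- Phi zsol g)); rewrite -!hcoefB Pg hcoef_constM.
  by rewrite /= /hmono_fun eqxx mulr1 divfK.
apply: (addIr (- Phi zsol e)); rewrite -!hcoefB.
by rewrite Peq // dg.
Qed.

End Solution.

(** With [z = 1 + t] the equation becomes [t * (2 + t) = x]; the difference quotient of the left
    side is [2 + t + s], with constant coefficient 2. *)
Lemma infinitesimal_sqrt x : 2%:R != 0 :> F -> infinitesimal x ->
  exists z, z ^+ 2 = 1 + x.
Proof.
move=> two0 xi.
have v2 t s : infinitesimal t -> infinitesimal s ->
    vanish_below (1 *+ 2 + t + s) 0 /\ (1 *+ 2 + t + s) 0 = 2%:R.
  move=> [t0 t00] [s0 s00]; split.
    apply: vanish_belowD => //; apply: vanish_belowD => //.
    by rewrite mulr2n; apply: vanish_belowD; exact: vanish_below1.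
  by rewrite mulr2n !hcoefD t00 s00 !hcoef1 eqxx !addr0.
have inf0 : infinitesimal 0 by [].
have [||t _ tE] := @infinitesimal_solve (fun t => t * (1 *+ 2 + t)) _ x two0 xi.
- move=> t ti; apply: infinitesimalM => //.
  by rewrite -(addr0 (1 *+ 2 + t)); case: (v2 t 0).
- move=> t s ti si; exists (1 *+ 2 + t + s); case: (v2 t s) => // ? ?.
  by split => //; ring.
by exists (1 + t); rewrite -tE; ring.
Qed.

(** With [z = 1 + t] the equation becomes [t * (1 + x) = - x], which is linear in [t]. *)
Lemma infinitesimal_inv x : infinitesimal x -> exists z, z * (1 + x) = 1.
Proof.
move=> xi; have [x0 x00] := xi.
have v1 : vanish_below (1 + x) 0.
  by apply: vanish_belowD => //; exact: vanish_below1.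
have [|||t _ tE] := @infinitesimal_solve (fun t => t * (1 + x)) 1 (- x)
  (oner_neq0 _).
- by split; [exact: vanish_belowN|rewrite hcoefN x00 oppr0].
- by move=> t ti; exact: infinitesimalM.
- move=> t s ti si; exists (1 + x); split=> //; first by ring.
  by rewrite hcoefD x00 addr0 hcoef1 eqxx.
by exists (1 + t); rewrite mulrDl tE; ring.
Qed.

(** Taking out the leading term reduces inverses and square roots to series 1 + t with t
    infinitesimal. *)
Lemma hahn_unit_factor x m : vanish_below x m -> x m != 0 ->
  exists2 t, infinitesimal t & x = hconst G (x m) * hmono F m * (1 + t).
Proof.
move=> xm xm0; pose y := hconst G (x m)^-1 * hmono F (- m) * x.
have mm : hmono F m * hmono F (- m) = 1 by rewrite hmonoM subrr.
have cc : hconst G (x m) * hconst G (x m)^-1 = 1.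
  by rewrite hconstM mulfV // hconst1.
exists (y - 1); last first.
  by rewrite addrC subrK /y -[LHS]mul1r -[1]mulr1 -{1}mm -cc; ring.
have hm : vanish_below (hconst G (x m)^-1 * hmono F (- m)) (- m).
  by apply: vanish_below_constM; exact: vanish_below_hmono.
split; first by apply: vanish_belowB; [rewrite -(addNr m); exact: vanish_belowM
  |exact: vanish_below1].
have := hcoefM_lead hm xm; rewrite addNr hcoefB => ->.
by rewrite hcoef_constM /= /hmono_fun !eqxx mulr1 mulVf ?subrr.
Qed.

Lemma hahn_inv_ex x : x != 0 -> exists z, z * x = 1.
Proof.
move=> /hahn_leadP[m xm xm0]; have [t ti ->] := hahn_unit_factor xm xm0.
have [z zE] := infinitesimal_inv ti.
exists (hconst G (x m)^-1 * hmono F (- m) * z).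
have mm : hmono F (- m) * hmono F m = 1 by rewrite hmonoM addNr.
have cc : hconst G (x m)^-1 * hconst G (x m) = 1.
  by rewrite hconstM mulVf // hconst1.
transitivity ((hmono F (- m) * hmono F m)
  * (hconst G (x m)^-1 * hconst G (x m)) * (z * (1 + t))); first by ring.
by rewrite mm cc zE !mulr1.
Qed.

(** The default 0 is the inverse of 0 that the field structure asks for. *)
Definition hahn_inv x : hahn G F :=
  if pselect (exists z, z * x = 1) is left ex then projT1 (cid ex) else 0.

Let hahn_mulVf x : x != 0 -> hahn_inv x * x = 1.
Proof.
move=> /hahn_inv_ex ex; rewrite /hahn_inv; case: pselect => // ex'.
by case: cid.
Qed.

Let hahn_inv0 : hahn_inv 0 = 0.
Proof.
rewrite /hahn_inv; case: pselect => // ex; exfalso; case: ex => z /eqP.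
by rewrite mulr0 eq_sym oner_eq0.
Qed.

HB.instance Definition _ :=
  GRing.ComNzRing_isField.Build (hahn G F) hahn_mulVf hahn_inv0.

End Solve.

(** * Quadratic forms and Cholesky factorization *)

Lemma quad_formE (S : comNzRingType) n (A : 'M[S]_n) (v : 'cV[S]_n) :
  (v^T *m A *m v) 0 0 = \sum_i \sum_j v i 0 * v j 0 * A i j.
Proof.
rewrite -mulmxA mxE; apply: eq_bigr => i _; rewrite !mxE mulr_sumr.
by apply: eq_bigr => j _; ring.
Qed.

Lemma dotmxC (S : comNzRingType) n (u v : 'cV[S]_n) :
  (u^T *m v) 0 0 = (v^T *m u) 0 0.
Proof. by rewrite -[v in LHS]trmxK -trmx_mul mxE. Qed.

(** Positivity enters as squareness of the values of the form. The first row and column are split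
    off, and the induction continues with the Schur complement [D - w *m w^T]. *)
Lemma cholesky (F : fieldType) n (A : 'M[F]_n) : (forall z : F, z ^+ 2 != -1) ->
  A^T = A -> (forall v : 'cV_n, exists z, z ^+ 2 = (v^T *m A *m v) 0 0) ->
  exists B : 'M_n, A = B *m B^T.
Proof.
move=> nsq; elim: n A => [|n IH] A Asym Asq.
  by exists 0; apply/matrixP => -[].
have [a [c [D [AE Dsym]]]] : exists a c D,
    A = block_mx a%:M c^T c D :> 'M_(1 + n) /\ D^T = D.
  exists (A 0 0), (dlsubmx (A : 'M_(1 + n))), (drsubmx (A : 'M_(1 + n))).
  split; last by rewrite trmx_drsub Asym.
  rewrite trmx_dlsub Asym -[LHS](submxK (A : 'M_(1 + n))); congr block_mx.
  by rewrite [LHS]mx11_scalar !mxE; congr (A _ _)%:M; apply: val_inj.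
have qE t (u : 'cV[F]_n) : exists z, z ^+ 2 =
    t ^+ 2 * a + (t * (c^T *m u) 0 0) *+ 2 + (u^T *m D *m u) 0 0.
  have [z zE] := Asq (col_mx t%:M u : 'cV_(1 + n)); exists z; rewrite zE AE.
  rewrite (tr_col_mx (t%:M : 'M_1) u) (@mul_row_block _ 1 1 n 1 n).
  rewrite (@mul_row_col _ 1 1 n 1) tr_scalar_mx.
  rewrite !mulmxDl !mul_scalar_mx !mul_mx_scalar -scalemxAl.
  move: (u^T *m c) (c^T *m u) (u^T *m D *m u) (dotmxC u c) => X Y Z XY.
  by rewrite !mxE XY eqxx mulr1n; ring.
have [z za] : exists z, z ^+ 2 = a.
  have [z zE] := qE 1 0; exists z; rewrite zE.
  by rewrite !mulmx0 !mxE expr1n mul1r mulr0 mul0rn !addr0.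
(* If 2 = 0, then -1 = 1 would be a square. *)
have two0 : 2%:R != 0 :> F.
  apply/eqP => two0; have := nsq 1; rewrite expr1n -subr_eq0 opprK.
  by rewrite -(natrD _ 1 1) two0 eqxx.
have [w [cw w0]] : exists w, c = z *: w /\ (z = 0 -> w = 0).
  have [z0|z0] := eqVneq z 0; last first.
    exists (z^-1 *: c); rewrite scalerA mulfV ?scale1r //; split=> // /eqP.
    by rewrite (negPf z0).
  exists 0; split=> //; rewrite scaler0; apply/matrixP => i j; rewrite ord1 mxE.
  (* With a zero corner and [c i 0] nonzero the form is affine in the first coordinate; the
     coordinate chosen here gives it the value -1, which is not a square. *)
  apply: contrapT => /eqP ci0; pose u : 'cV[F]_n := delta_mx i 0.
  have [y] := qE ((- 1 - (u^T *m D *m u) 0 0) / (2%:R * c i 0)) u.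
  rewrite -za z0 expr0n mulr0 add0r.
  have -> : (c^T *m u) 0 0 = c i 0 by rewrite -colE !mxE.
  have -> x : (x / (2%:R * c i 0) * c i 0) *+ 2 = x.
    by rewrite -mulr_natl; field; rewrite ci0.
  by rewrite subrK => /eqP; rewrite (negPf (nsq y)).
have [|u|B' B'E] := IH (D - w *m w^T).
- by rewrite linearB /= Dsym trmx_mul trmxK.
- have cu u' : (c^T *m u') 0 0 = z * (w^T *m u') 0 0.
    by rewrite cw linearZ /= -scalemxAl mxE.
  have SE : (u^T *m (D - w *m w^T) *m u) 0 0 =
      (u^T *m D *m u) 0 0 - (w^T *m u) 0 0 ^+ 2.
    rewrite mulmxBr mulmxBl mxE; congr (_ + _); rewrite mxE; congr (- _).
    by rewrite -!mulmxA mulmxA mxE big_ord1 dotmxC.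
  have [z0|z0] := eqVneq z 0.
    have [y yE] := qE 0 u; exists y; rewrite yE SE w0 // trmx0 mul0mx !mxE.
    by ring.
  (* This first coordinate completes the square and leaves the form of the Schur complement at
     [u]. *)
  have [y yE] := qE (- (w^T *m u) 0 0 / z) u; exists y; rewrite yE SE cu -za.
  by field.
exists (block_mx z%:M 0 w B' : 'M_(1 + n)).
rewrite AE (tr_block_mx (z%:M : 'M_1)) (@mulmx_block _ 1 n 1 n 1 n).
rewrite -B'E tr_scalar_mx trmx0 !mulmx0 mul0mx !addr0 -scalar_mxM -expr2 za.
by rewrite mul_scalar_mx mul_mx_scalar -cw cw linearZ addrC subrK.
Qed.

(** * The order of the field of Hahn series *)

Section HahnOrder.
Variables (G : orderedZmodType) (R : rcfType).
Implicit Types (x y : hahn G R) (m : G).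

(** The leading coefficient of a nonzero square is a nonzero square. Conversely, a root is assembled
    from roots of three factors: the leading coefficient, the monomial (by divisibility) and 1 + t
    (by [infinitesimal_sqrt]). *)
Lemma hahn_le0P y : divisible G -> hahn_le 0 y <->
  (y = 0 \/ exists2 m, vanish_below y m & 0 < y m).
Proof.
move=> divG; split=> [[z]|[->|[m ym ym0]]].
- rewrite addr0 => <-; have [->|/hahn_leadP[m zm zm0]] := eqVneq z 0.
    by left; rewrite expr0n.
  right; exists (m + m); first exact: vanish_belowM.
  by rewrite hcoefM_lead // -expr2 exprn_even_gt0.
- by exists 0; rewrite expr0n addr0.
have [t ti yE] := hahn_unit_factor ym (lt0r_neq0 ym0).
have [z zE] := infinitesimal_sqrt (lt0r_neq0 (ltr0n _ 2)) ti.
have [h hm] := divG 2 m isT.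
exists (hconst G (Num.sqrt (y m)) * hmono R h * z).
rewrite addr0 exprMn exprMn zE [RHS]yE !expr2 hmonoM -mulr2n hm hconstM.
by rewrite -expr2 sqr_sqrtr // ltW.
Qed.

(** Two positive leading coefficients cannot cancel. *)
Lemma hahn_le0D x y : divisible G ->
  hahn_le 0 x -> hahn_le 0 y -> hahn_le 0 (x + y).
Proof.
move=> divG /(hahn_le0P _ divG)[->|[m xm xm0]]; first by rewrite add0r.
move=> /(hahn_le0P _ divG)[->|[n yn yn0]].
  by rewrite addr0; apply/(hahn_le0P _ divG); right; exists m.
apply/(hahn_le0P _ divG); right.
have [mn|nm|mn] := ltgtP m n.
- exists m; last by rewrite hcoefD yn // addr0.
  by apply: vanish_belowD => //; apply: vanish_belowW (ltW mn) _.
- exists n; last by rewrite hcoefD xm // add0r.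
  by apply: vanish_belowD => //; apply: vanish_belowW (ltW nm) _.
exists m; first by apply: vanish_belowD; rewrite // mn.
by rewrite hcoefD addr_gt0 // mn.
Qed.

Lemma hahn_le0_sum (I : Type) (r : seq I) (P : pred I) (F : I -> hahn G R) :
  divisible G -> (forall i, P i -> hahn_le 0 (F i)) ->
  hahn_le 0 (\sum_(i <- r | P i) F i).
Proof.
move=> divG F0; elim/big_ind: _ => //; first by exists 0; rewrite expr0n addr0.
by move=> x y; exact: hahn_le0D.
Qed.

(** The leading coefficient of a nonzero square is positive, whereas all coefficients of -1 are at
    most 0. *)
Lemma hahn_sqr_neqN1 x : x ^+ 2 != -1.
Proof.
apply/eqP => xE; have x0 : x != 0.
  by apply: contra_eq_neq xE => ->; rewrite expr0n eq_sym oppr_eq0 oner_eq0.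
have [m xm xm0] := hahn_leadP x0.
have := hcoefM_lead xm xm; rewrite -!expr2 xE hcoefN hcoef1 => /esym/eqP.
have : 0 < x m ^+ 2 by rewrite exprn_even_gt0.
by move=> xm2; rewrite gt_eqF // (le_lt_trans _ xm2) // oppr_le0 ler0n.
Qed.

Lemma hconst_ge0 c : divisible G -> hahn_le 0 (hconst G c : hahn G R) -> 0 <= c.
Proof.
move=> divG /(hahn_le0P _ divG)[|[m _]].
  by move=> /(congr1 (fun x => hcoef x 0)); rewrite hcoef_const eqxx => ->.
by rewrite hcoef_const; case: eqP => _; rewrite ?ltxx // => /ltW.
Qed.

End HahnOrder.

(** * Elimination by orders and passage to fewer points *)

(** Minimality is phrased with [vanish_below] because [hord 0] is a junk value. *)
Lemma hord_min_ex (G : orderedZmodType) (R : nzRingType) (s : seq (hahn G R)) :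
  has (fun x => x != 0) s ->
  exists x, [/\ x \in s, x != 0 & forall y, y \in s -> vanish_below y (hord x)].
Proof.
elim: s => //= x s IH; have [->|x0 _] /= := eqVneq x 0.
  move=> /IH[y [ys y0 ymin]]; exists y; rewrite inE ys orbT; split=> // z.
  by rewrite inE => /predU1P[->//|/ymin].
have [/IH[y [ys y0 ymin]]|/hasPn s0] := boolP (has (fun z => z != 0) s);
  last first.
  exists x; rewrite mem_head; split=> // y; rewrite inE => /predU1P[->|/s0].
    exact: vanish_below_hord.
  by rewrite negbK => /eqP ->.
have [xy|/ltW yx] := leP (hord x) (hord y).
  exists x; rewrite mem_head; split=> // z; rewrite inE => /predU1P[->|/ymin].
    exact: vanish_below_hord.
  exact: vanish_belowW.
exists y; rewrite inE ys orbT; split=> // z.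
rewrite inE => /predU1P[->|/ymin//].
by apply: vanish_belowW yx _; exact: vanish_below_hord.
Qed.

(* The last clause only strengthens the induction. *)
Lemma hahn_echelon (G : orderedZmodType) (F : fieldType) (s : seq (hahn G F)) :
  exists t : seq (hahn G F), [/\ (size t <= size s)%N,
    {in t, forall x, x != 0}, uniq (map (@hord G F) t),
    forall x, x \in s -> exists c : nat -> F,
      x = \sum_(j < size t) hconst G (c j) * t`_j &
    forall m, (forall x, x \in s -> forall e, e <= m -> x e = 0) ->
      forall x, x \in t -> forall e, e <= m -> x e = 0].
Proof.
have [n sn] := ubnP (size s); elim: n s sn => // n IH s.
have [/hord_min_ex[w [ws w0 wmin]] sn|/hasPn s0 _] :=
  boolP (has (fun x => x != 0) s); last first.
  exists [::]; split=> // x /s0; rewrite negbK => /eqP ->.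
  by exists (fun=> 0); rewrite big_ord0.
pose o := hord w.
(* Gaussian elimination with a pivot [w] of least order: the reduced series vanish up to and
   including [o]. *)
pose red (x : hahn G F) : hahn G F := x - hconst G (x o / w o) * w.
have red0 x : x \in s -> forall e, e <= o -> red x e = 0.
  move=> /wmin xo e; rewrite /red hcoefB hcoef_constM.
  rewrite le_eqVlt => /predU1P[->|eo].
    by rewrite divfK ?subrr // hord_neq0.
  by rewrite xo // (vanish_below_hord eo) mulr0 subrr.
have sz : size (map red (rem w s)) = (size s).-1 by rewrite size_map size_rem.
have s0 : (0 < size s)%N by case: (s) ws.
have rem_s x : x \in rem w s -> x \in s by exact: mem_rem.
have [|t [st t0 tu tc tm]] := IH (map red (rem w s)).
  by rewrite sz -ltnS prednK.
(* The last clause of the induction hypothesis at [m = o] puts the orders in [t] beyond [o], so the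
   order of the pivot is new. *)
have to x : x \in t -> forall e, e <= o -> x e = 0.
  by apply: tm => _ /mapP[y /rem_s ys ->]; exact: red0.
have wt : o \notin map (@hord G F) t.
  apply/mapP => -[x xt oE]; have := hord_neq0 (t0 x xt).
  by rewrite -oE to ?eqxx.
exists (w :: t); split=> /=.
- by rewrite -(prednK s0) ltnS -sz.
- by move=> x; rewrite inE => /predU1P[->|/t0].
- by rewrite wt.
- move=> x xs; have [xw|xw] := eqVneq x w.
    exists (fun j => (j == 0)%:R); rewrite big_ord_recl /= hconst1 mul1r.
    rewrite big1 ?addr0 // => j _; apply: hahnP => e.
    by rewrite hcoef_constM mul0r.
  have [|c xc] := tc (red x); first by rewrite map_f // rem_mem.
  exists (fun j => if j is j'.+1 then c j' else x o / w o).
  by rewrite big_ord_recl /= -xc /red addrC subrK.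
move=> m sm x; rewrite inE => /predU1P[->|]; first exact: sm.
apply: tm => _ /mapP[y /rem_s ys ->] e em.
by rewrite /red hcoefB hcoef_constM (sm y ys e em) (sm w ws e em) mulr0 subrr.
Qed.

(** Elimination may leave fewer than [k] series. To drop a point, a new one is adjoined with
    coordinate 0 in the test vector. *)
Lemma kpd_le (G : orderedZmodType) (R : numDomainType) (k r : nat)
    (f : G -> R) :
  ((1 < k)%N -> exists e : G, e != 0) -> (r <= k)%N -> kpd k f -> kpd r f.
Proof.
move=> Gk rk fk; pose P j := kpd j f.
have step j : (j < k)%N -> P j.+1 -> P j.
  move=> jk fj x xinj; split; first by apply/matrixP => a b; rewrite !mxE addrC.
  move=> v v0.
  have [y yx] : exists y, forall i, y != x i.
    (* Without earlier points any [y] is new; otherwise [1 < k], so [G] is nontrivial and [y] is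
       taken above all [x i]. *)
    case: j jk x xinj {fj v v0} => [|j] jk x _; first by exists 0 => -[].
    have [|y /allP ylt] := ozmod_seq_ub (codom x).
      by apply: Gk; apply: leq_ltn_trans jk.
    by exists y => i; rewrite gt_eqF // ylt // codom_f.
  pose x' (i : 'I_j.+1) := if unlift ord0 i is Some i' then x i' else y.
  have x'0 : x' ord0 = y by rewrite /x' unlift_none.
  have x'S i : x' (lift ord0 i) = x i by rewrite /x' liftK.
  have x'inj : injective x'.
    move=> a b; case: (unliftP ord0 a) => [a'|] ->;
      case: (unliftP ord0 b) => [b'|] ->; rewrite ?x'0 ?x'S //.
    - by move=> /xinj ->.
    - by move=> /esym/eqP; rewrite (negPf (yx _)).
    - by move=> /eqP; rewrite (negPf (yx _)).
  pose v' : 'cV[R]_j.+1 :=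
    \col_i (if unlift ord0 i is Some i' then v i' 0 else 0).
  have v'0 : v' ord0 0 = 0 by rewrite mxE unlift_none.
  have v'S i : v' (lift ord0 i) 0 = v i 0 by rewrite mxE liftK.
  have [_ /(_ v')] := fj _ x'inj.
  have v'n0 : v' != 0.
    apply: contra_neq v0 => v'E; apply/matrixP => i l.
    by rewrite ord1 -v'S v'E !mxE.
  rewrite !quad_formE big_ord_recl big1 ?add0r => [/(_ v'n0)|i _]; last first.
    by rewrite v'0 !mul0r.
  congr (_ < _); apply: eq_bigr => a _.
  rewrite big_ord_recl v'0 mulr0 mul0r add0r.
  by apply: eq_bigr => b _; rewrite !v'S !mxE !x'S.
have H d : (d <= k)%N -> P (k - d)%N.
  elim: d => [|d IH] dk; first by rewrite subn0.
  apply: step; first by rewrite ltn_subrL (leq_ltn_trans _ dk).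
  by rewrite subnSK //; apply/IH/ltnW.
by rewrite -(subKn rk); apply: H; exact: leq_subr.
Qed.

(** * Positivity for matrices of rank one *)

Section Rank1.
Variables (G : orderedZmodType) (R : rcfType) (f : G -> R).
Hypothesis divG : divisible G.
Let L := hahn_diag f.

Lemma hahn_diag_rank1_distinct r (b w : 'I_r -> hahn G R) : kpd r f ->
  (forall i, w i != 0) -> injective (fun i => hord (w i)) ->
  hahn_le 0 (\sum_i \sum_j w i * w j * L (b i * b j)).
Proof.
move=> fr w0 winj; apply/(hahn_le0P _ divG).
have [/existsP[i0 bi0]|/existsPn b0] := boolP [exists i, b i != 0]; last first.
  left; rewrite big1 // => i _; rewrite big1 // => j _.
  have /negbNE/eqP -> := b0 i; rewrite mul0r.
  by rewrite (_ : L 0 = 0) ?mulr0 //; apply: hahnP => e; rewrite /= mulr0.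
right.
case: (@arg_minP _ _ _ i0 (fun i => b i != 0)
  (fun i => hord (b i) + hord (w i))) => // i1 bi1 i1min.
set m := hord (b i1) + _ in i1min.
(* By minimality of [m], [e i] bounds the order of [b i] from below; [b i] may start later, and then
   [b i (e i) = 0]. *)
pose e i := m - hord (w i).
have be i : vanish_below (b i) (e i).
  have [->|bi] := eqVneq (b i) 0; first exact: vanish_below0.
  apply: (@vanish_belowW _ _ _ _ (hord (b i))); last exact: vanish_below_hord.
  by rewrite -(ozmod_leD2r (hord (w i))) subrK i1min.
have einj : injective e by move=> i j /subrI /winj.
have eE i j : hord (w i) + hord (w j) + (e i + e j) = m + m.
  by rewrite addrACA /e ![hord _ + (m - _)]addrC !subrK.
have ww i j := vanish_belowM (@vanish_below_hord _ _ (w i))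
                 (@vanish_below_hord _ _ (w j)).
have bb i j : vanish_below (L (b i * b j)) (e i + e j).
  by apply: vanish_below_diag; exact: vanish_belowM.
exists (m + m).
  apply: vanish_below_sum => i _; apply: vanish_below_sum => j _.
  by rewrite -(eE i j); exact: vanish_belowM.
(* The entry at [i1] is a product of two leading coefficients, since [e i1 = hord (b i1)]; hence [v]
   is nonzero. *)
pose v : 'cV[R]_r := \col_i (w i (hord (w i)) * b i (e i)).
have v0 : v != 0.
  apply/eqP => /matrixP/(_ i1 0) /eqP; rewrite !mxE mulf_eq0.
  rewrite (negPf (hord_neq0 (w0 i1))) /e /m addrK.
  by rewrite (negPf (hord_neq0 bi1)).
have [_ /(_ v v0)] := fr e einj.
rewrite quad_formE hcoef_sum; congr (_ < _); apply: eq_bigr => i _.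
rewrite hcoef_sum; apply: eq_bigr => j _; rewrite !mxE -(eE i j).
rewrite (hcoefM_lead (ww i j) (bb i j)).
rewrite hcoefM_lead; try exact: vanish_below_hord.
by rewrite hcoef_diag hcoefM_lead //; ring.
Qed.

(** Elimination writes [w i] as a combination of the [t_j], which have distinct orders, with
    constants [c i j]. Linearity of [L] over [R] moves these constants into the family [b], which
    becomes [b']. *)
Lemma hahn_diag_rank1 k (b w : 'I_k -> hahn G R) :
  ((1 < k)%N -> exists e : G, e != 0) -> kpd k f ->
  hahn_le 0 (\sum_i \sum_j w i * w j * L (b i * b j)).
Proof.
move=> Gk fk; have [t [st t0 tu tc _]] := hahn_echelon (codom w).
rewrite size_map size_enum_ord in st.
have [c wE] := choice (fun i => tc (w i) (codom_f w i)).
pose c' i j := hconst G (c i j) : hahn G R.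
pose b' (j : 'I_(size t)) := \sum_i c' i j * b i.
have -> : \sum_i \sum_j w i * w j * L (b i * b j) =
    \sum_(i < size t) \sum_(j < size t) t`_i * t`_j * L (b' i * b' j).
  (* Both sides expand to this fourfold sum. *)
  transitivity (\sum_(a < k) \sum_(i < size t) \sum_(d < k) \sum_(j < size t)
    c' a i * c' d j * (t`_i * t`_j * L (b a * b d))).
    apply: eq_bigr => a _; rewrite exchange_big /=; apply: eq_bigr => d _.
    rewrite {1}wE {1}(wE d) !mulr_suml; apply: eq_bigr => i _.
    rewrite mulr_sumr mulr_suml; apply: eq_bigr => j _.
    by rewrite -/(c' a i) -/(c' d j); ring.
  rewrite exchange_big; apply: eq_bigr => i _ /=.
  rewrite [RHS](eq_bigr (fun j : 'I_(size t) =>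
    \sum_a \sum_d c' a i * c' d j * (t`_i * t`_j * L (b a * b d)))) => [|j _].
    rewrite [RHS]exchange_big; apply: eq_bigr => a _ /=.
    by rewrite exchange_big.
  rewrite /L /b' mulr_suml hahn_diag_sum mulr_sumr; apply: eq_bigr => a _.
  rewrite mulr_sumr hahn_diag_sum mulr_sumr; apply: eq_bigr => d _.
  have -> : c' a i * b a * (c' d j * b d) = c' a i * (c' d j * (b a * b d)).
    by ring.
  rewrite 2!hahn_diag_constM -/(c' a i) -/(c' d j) -/L.
  by ring.
apply: hahn_diag_rank1_distinct.
- exact: kpd_le fk.
- by move=> i; apply/t0/mem_nth.
move=> i j ij; apply/val_inj/eqP; rewrite -(nth_uniq 0 _ _ tu) ?size_map //=.
by rewrite !(nth_map 0) // ij.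
Qed.

End Rank1.

(* In part (1), Lam = 0 is excluded when k > 1: being k-positive definite is
   then vacuous, as Lam has no k pairwise different elements, and part (1)
   fails for the constant function f = -1. *)
Theorem theorem2p13 (RR : realType) (R : rcfType) (iota : {rmorphism RR -> R})
    (Lam : orderedZmodType) (hdiv : divisible Lam) (k : nat) (hk : (0 < k)%N)
    (f : Lam -> R) :
  (((1 < k)%N -> exists e : Lam, e != 0) ->
     kpd k f -> kpositive k (hahn_diag f : hahn Lam R -> hahn Lam R)) /\
  (kpositive k (hahn_diag f : hahn Lam R -> hahn Lam R) -> kpsd k f).
Proof.
split=> [Lam0 fk A [Asym Apsd]|Lpos x].
  split; first by rewrite map_trmx Asym.
  have [|B AE] := cholesky (@hahn_sqr_neqN1 Lam R) Asym.
    by move=> v; have [z] := Apsd v; rewrite addr0; exists z.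
  move=> v; rewrite quad_formE.
  (* The form of L_f(B B^T) splits into one rank one form for each column of [B]. *)
  rewrite (_ : \sum_i _ = \sum_m \sum_i \sum_j
      v i 0 * v j 0 * hahn_diag f (B i m * B j m)); last first.
    rewrite [RHS]exchange_big; apply: eq_bigr => i _ /=.
    rewrite [RHS]exchange_big; apply: eq_bigr => j _ /=.
    rewrite -mulr_sumr -hahn_diag_sum AE !mxE; congr (_ * hahn_diag f _).
    by apply: eq_bigr => m _; rewrite mxE.
  apply: hahn_le0_sum => // m _.
  exact: (hahn_diag_rank1 hdiv (fun i => B i m) (fun i => v i 0)).
split; first by apply/matrixP => i j; rewrite !mxE addrC.
pose A : 'M[hahn Lam R]_k := \matrix_(i, j) hmono R (x i + x j).
have [|_ LA] := Lpos A.
  split; first by apply/matrixP => i j; rewrite !mxE addrC.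
  (* The form of [A] at [v] is the square of this sum. *)
  move=> v; exists (\sum_i v i 0 * hmono R (x i)).
  rewrite addr0 quad_formE expr2 mulr_suml; apply: eq_bigr => i _.
  rewrite mulr_sumr; apply: eq_bigr => j _.
  by rewrite mxE -hmonoM; ring.
move=> v; apply: (hconst_ge0 hdiv).
(* The powers of epsilon cancel in this form, so its value is the constant series of the form of [f]
   at [v]. *)
have := LA (\col_i (hconst Lam (v i 0) * hmono R (- x i))).
congr (hahn_le 0 _); apply: hahnP => e.
rewrite !quad_formE hcoef_sum hcoef_const.
transitivity (\sum_i \sum_j
    hconst Lam (v i 0 * v j 0 * f (x i + x j)) e : R); last first.
  have [e0|e0] := eqVneq e 0.
    apply: eq_bigr => i _; apply: eq_bigr => j _.
    by rewrite hcoef_const e0 eqxx mxE.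
  rewrite big1 // => i _; rewrite big1 // => j _.
  by rewrite hcoef_const (negPf e0).
apply: eq_bigr => i _; rewrite hcoef_sum; apply: eq_bigr => j _.
congr (hcoef _ e); rewrite !mxE hahn_diag_hmono -!hconstM.
have mono1 : hmono R (- x i) * hmono R (- x j) * hmono R (x i + x j) = 1.
  by rewrite !hmonoM -opprD addNr.
by rewrite -[RHS]mulr1 -mono1; ring.
Qed.
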